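(* Let $\tau>0$, let $f:[0,\infty)\to[0,\infty)$ be an $S$-map, and let $K$ be the unique fixed point of $f$. Consider the delay differential equation $$x'(t)=-x(t)+f(x(t-\tau)).\qquad ( * )$$ Then: (a) If $|f'(K)|\le 1$, then $\lim_{t\to\infty}x(t)=K$ for every nonnegative solution $x(t)$ of $( * )$. (b) If $|f'(K)|>1$, then $$\alpha\le\liminf_{t\to\infty}x(t)\le\limsup_{t\to\infty}x(t)\le\beta$$ for every nonnegative solution $x(t)$ of $( * )$, where $\{\alpha,\beta\}$, $\alpha<\beta$, is the unique $2$-cycle of $f$.
   Context: For a $C^3$ map $f$, the Schwarzian derivative is $(Sf)(x)=\frac{f'''(x)}{f'(x)}-\frac32\left(\frac{f''(x)}{f'(x)}\right)^2$ whenever $f'(x)\neq 0$. A map $f:I\to I$, with $I=[0,\infty)$, is an $S$-map if it is three times differentiable, and $(Sf)(x)<0$ and $f'(x)<0$ for all $x\in I$. A $2$-cycle of $f$ is a set $\{\alpha,\beta\}$ with $\alpha\ne\beta$, $f(\alpha)=\beta$ and $f(\beta)=\alpha$. A nonnegative solution of $( * )$ is a continuous function $x:[-\tau,\infty)\to[0,\infty)$, determined by a continuous nonnegative initial function on $[-\tau,0]$, which is differentiable and satisfies $( * )$ for all $t>0$. *)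

(* Defs.v *)
From HB Require Import structures.
From mathcomp Require Export all_boot all_order all_algebra.
From mathcomp Require Export all_classical all_reals all_analysis.

Set Implicit Arguments.
Unset Strict Implicit.
Unset Printing Implicit Defensive.

Import Order.TTheory GRing.Theory Num.Theory.
Import numFieldNormedType.Exports.

Local Open Scope classical_set_scope.
Local Open Scope ring_scope.

(* Maps of the half-line are total functions f : R -> R; what follows only
   uses the values of f on [halfline R]. *)
Definition halfline (R : realType) : set R := [set y : R | 0 <= y].
Arguments halfline : clear implicits.

(* The derivative relative to a domain D: two-sided at interior points of D,
   one-sided at an end point.  The library's [derive1] at 0 would depend on the
   values of f on negative reals. *)
Definition diff_quot_in (R : realType) (D : set R) (f : R -> R) (y : R)
    : set_system R :=
  (f z - f y) / (z - y) @[z --> within D y^'].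

Definition derivable_in (R : realType) (D : set R) (f : R -> R) (y : R) : Prop :=
  cvg (diff_quot_in D f y).

Definition derive_in (R : realType) (D : set R) (f : R -> R) (y : R) : R :=
  lim (diff_quot_in D f y).

Definition derive_in_n (R : realType) (D : set R) (n : nat) (f : R -> R)
    : R -> R :=
  iter n (derive_in D) f.

Definition schwarzian (R : realType) (D : set R) (f : R -> R) (y : R) : R :=
  derive_in_n D 3 f y / derive_in_n D 1 f y
  - 3 / 2 * (derive_in_n D 2 f y / derive_in_n D 1 f y) ^+ 2.

Definition S_map (R : realType) (f : R -> R) : Prop :=
  [/\ forall y : R, halfline R y -> halfline R (f y),
      forall (n : nat) (y : R), (n < 3)%N -> halfline R y ->
        derivable_in (halfline R) (derive_in_n (halfline R) n f) y,
      forall y : R, halfline R y -> schwarzian (halfline R) f y < 0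
    & forall y : R, halfline R y -> derive_in (halfline R) f y < 0].

Definition fixed_point (R : realType) (f : R -> R) (y : R) : Prop :=
  halfline R y /\ f y = y.

Definition two_cycle (R : realType) (f : R -> R) (C : set R) : Prop :=
  exists a b : R, [/\ C = [set a; b], halfline R a /\ halfline R b, a <> b,
                      f a = b & f b = a].

Definition nonneg_solution (R : realType) (tau : R) (f x : R -> R) : Prop :=
  [/\ {within [set t : R | - tau <= t], continuous x},
      forall t : R, - tau <= t -> 0 <= x t
    & forall t : R, 0 < t ->
        derivable x t 1 /\ derive1 x t = - x t + f (x (t - tau))].

Definition liminf_infty (R : realType) (x : R -> R) : \bar R :=
  limf_einf (fun t => (x t)%:E) (pinfty_nbhs R).

Definition limsup_infty (R : realType) (x : R -> R) : \bar R :=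
  limf_esup (fun t => (x t)%:E) (pinfty_nbhs R).

(* Main.v *)
(* Put h = |f'|^(-1/2).  Then h'' = - h * Sf / 2 > 0, so h is strictly convex.
   Let a < a' <= b' < b with f swapping a with b, and a' with b' (or
   a' = b' = K).  Comparing f with the Moebius maps whose derivative is
   -1/l^2, l being the chord of h through a', b' (its tangent at K if
   a' = b' = K), gives h(a') h(b') >= 1 for a 2-cycle and h(a') h(b') < 1 for
   the inner pair of two nested ones.  Hence the 2-cycle is unique, and there is
   none when |f'(K)| = 1 / h(K)^2 <= 1.

   For a solution x let A and B be its lower and upper limits.  Comparison with
   x' = -x + c gives f(B) <= A and B <= f(A), so f(f(A)) <= A.  As f(f(0)) > 0,
   the map f o f has a fixed point in (0, A], which is K or belongs to the
   2-cycle; this bounds A from below and B <= f(A) from above. *)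
Require Import Defs.
From mathcomp Require Import ring lra.
Import Order.TTheory GRing.Theory Num.Theory.
Import numFieldNormedType.Exports.
Local Open Scope classical_set_scope.
Local Open Scope ring_scope.
Set Implicit Arguments.
Unset Strict Implicit.
Unset Printing Implicit Defensive.

(** * Mean value theorem for two points *)

Lemma mvt_lt (R : realType) (f df : R -> R) (a b : R) : a < b ->
  (forall w, a <= w <= b -> is_derive w 1 f (df w)) ->
  exists2 c, a < c < b & f b - f a = df c * (b - a).
Proof.
move=> ab dfE.
have df' w : w \in `]a, b[%R -> is_derive w 1 f (df w).
  by rewrite in_itv/= => /andP[aw wb]; apply: dfE; rewrite !ltW.
have cf : {within `[a, b], continuous f}.
  apply: continuous_in_subspaceT => w; rewrite inE/= in_itv/= => /dfE dw.
  by apply: differentiable_continuous; apply/derivable1_diffP; apply: ex_derive.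
by have [c] := MVT ab df' cf; rewrite in_itv/= => cab E; exists c.
Qed.

Lemma mvt_neq (R : realType) (f df : R -> R) (z y : R) : z != y ->
  (forall w, (z <= w <= y) || (y <= w <= z) -> is_derive w 1 f (df w)) ->
  exists2 c, (z < c < y) || (y < c < z) & f y - f z = df c * (y - z).
Proof.
rewrite neq_lt => /orP[zy|yz] dfE.
- have [w zwy|c czy E] := mvt_lt zy (df := df) (f := f).
    by apply: dfE; rewrite zwy.
  by exists c; rewrite ?czy.
- have [w zwy|c czy E] := mvt_lt yz (df := df) (f := f).
    by apply: dfE; rewrite zwy orbT.
  by exists c; [rewrite czy orbT|lra].
Qed.

(** * Comparison of a decreasing map with Moebius maps *)

Lemma is_derive_mobius (R : realType) (c s z w : R) : c + s * (w - z) != 0 ->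
  is_derive w 1 (fun w : R => (w - z) / (c + s * (w - z)))
    (c * (c + s * (w - z)) ^- 2).
Proof.
move=> n0.
have d1 : is_derive w 1 (fun w => w - z) 1.
  by apply: is_derive_eq; rewrite subr0.
have d2 : is_derive w 1 (fun w => c + s * (w - z)) s.
  apply: (@is_derive_eq _ _ _ (cst c + s \*: (fun w => w - z))).
  by rewrite add0r /GRing.scale/= mulr1.
have d3 : is_derive w 1 (fun w => (c + s * (w - z))^-1)
   (- (c + s * (w - z)) ^- 2 * s) by apply: is_deriveV.
have d4 := is_deriveM d1 d3; apply: is_derive_eq => /=.
rewrite /GRing.scale/=; field; exact: n0.
Qed.

(** The factor [c^-1] normalises the derivative of the Moebius map to the inverse square of the
    line. When [f] has derivative [- (h w) ^- 2], the sum is then monotone according to whether the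
    positive line lies below or above [h]. *)
Lemma is_derive_mobius_add (R : realType) (f : R -> R) (c s z w k : R) :
  c != 0 -> c + s * (w - z) != 0 -> is_derive w 1 f k ->
  is_derive w 1 (fun w : R => c^-1 * ((w - z) / (c + s * (w - z))) + f w)
    ((c + s * (w - z)) ^- 2 + k).
Proof.
move=> c0 l0 df.
have := is_deriveD (is_deriveZ c^-1 (is_derive_mobius l0)) df.
by rewrite /GRing.scale/= mulrA mulVf// mul1r.
Qed.

(* The Moebius map [w |-> (w - z) / (h z * l w)], with [l] the line
   [h z + s * (w - z)], has derivative [(l w) ^- 2], which dominates
   [(h w) ^- 2] wherever [0 < l <= h]. *)
Lemma line_below_diff_lt (R : realType) (f h : R -> R) (z y s : R) :
  0 < z -> 0 < y -> z != y ->
  (forall w : R, 0 < w -> 0 < h w) ->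
  (forall w : R, 0 < w -> is_derive w 1 f (- (h w) ^- 2)) ->
  (forall w, (z < w <= y) || (y <= w < z) -> h z + s * (w - z) < h w) ->
  (h z + s * (y - z)) * `|f y - f z| < `|y - z| / h z.
Proof.
move=> z0 y0 zy h0 df hl.
set l := fun w => h z + s * (w - z).
have hz := h0 _ z0.
have R0 : 0 < `|y - z| / h z by rewrite divr_gt0// normr_gt0 subr_eq0 eq_sym.
(* If [l y <= 0] the left side is nonpositive and the right side positive. Otherwise the affine [l]
   is positive at both ends, hence in between, and the Moebius map has no pole there. *)
have [ly|ly] := leP (l y) 0.
  by apply: le_lt_trans R0; rewrite mulr_le0_ge0.
have l0 w : (z <= w <= y) || (y <= w <= z) -> 0 < l w.
  rewrite /l in ly *.
  move=> /orP[] /andP[? ?]; have [s0|s0] := leP 0 s; nra.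
have w0 w : (z <= w <= y) || (y <= w <= z) -> 0 < w.
  by move=> /orP[] /andP[? ?]; lra.
pose E w := (h z)^-1 * ((w - z) / l w) + f w.
have dE w : (z <= w <= y) || (y <= w <= z) ->
    is_derive w 1 E ((l w)^-2 - (h w)^-2).
  move=> wzy; have lw := l0 _ wzy.
  by apply: is_derive_mobius_add; rewrite ?lt0r_neq0//; apply/df/w0.
have [c cyz Ec] := mvt_neq zy dE.
have dc : 0 < (l c)^-2 - (h c)^-2.
  have cc : (z <= c <= y) || (y <= c <= z).
    by case/orP: cyz => /andP[? ?]; apply/orP; [left|right]; rewrite !ltW.
  rewrite subr_gt0 ltf_pV2 ?posrE ?exprn_gt0 ?h0 ?l0 ?w0//.
  rewrite ltr_pXn2r ?nnegrE ?ltW ?h0 ?l0 ?w0//.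
  by apply: hl; case/orP: cyz => /andP[? ?]; apply/orP; [left|right]; lra.
have yzE : `|y - z| ^+ 2 = (y - z) ^+ 2 by rewrite real_normK ?num_real.
have yz2 : 0 < `|y - z| ^+ 2 by rewrite exprn_gt0// normr_gt0 subr_eq0 eq_sym.
have Ezy : 0 < (y - z) * (E y - E z).
  by rewrite Ec mulrCA mulr_gt0// -expr2 -yzE.
(* As [f] has negative derivative, its increment and that of the argument have opposite signs; this
   turns the estimate into one on absolute values. *)
have [e eyz fe] := mvt_neq zy (fun w wzy => df w (w0 w wzy)).
have fyz : (y - z) * (f y - f z) = - (`|y - z| * `|f y - f z|).
  rewrite fe normrM normrN (@ger0_norm _ (h e ^- 2)) ?invr_ge0 ?sqr_ge0//.
  by rewrite mulrCA [in RHS]mulrCA -!expr2 yzE; lra.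
have EE : (y - z) * (E y - E z) =
    `|y - z| * ((h z)^-1 * (l y)^-1 * `|y - z| - `|f y - f z|).
  rewrite [RHS]mulrBr -fyz mulrCA -expr2 yzE /E; lra.
move: Ezy; rewrite EE pmulr_rgt0 ?normr_gt0 ?subr_eq0 1?eq_sym//.
rewrite subr_gt0 => lf; rewrite -ltr_pdivlMl// (lt_le_trans lf)//.
by rewrite -mulrA mulrCA [X in _ <= _ * X]mulrC.
Qed.

(** The convex [h] lies below its chord [l] on [[a, b]], so the comparison function [E] has
    derivative [(l w)^-2 - (h w)^-2 <= 0], and [E b <= E a] is the claim. For a 2-cycle,
    [f a - f b = b - a] turns it into [1 <= h a * h b]. *)
Lemma diff_le_chord (R : realType) (f h v : R -> R) (a b : R) :
  0 < a -> a < b ->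
  (forall w : R, 0 < w -> 0 < h w) ->
  (forall w : R, 0 < w -> is_derive w 1 f (- (h w) ^- 2)) ->
  (forall w : R, 0 < w -> is_derive w 1 h (v w)) ->
  (forall w u : R, 0 < w -> w < u -> v w < v u) ->
  b - a <= h a * h b * (f a - f b).
Proof.
move=> a0 ab h0 df dh vi.
pose s := (h b - h a) / (b - a).
pose l w := h a + s * (w - a).
have hl w : a <= w <= b -> h w <= l w.
  move=> /andP[]; rewrite le_eqVlt => /orP[/eqP<- _|aw].
    by rewrite /l subrr mulr0 addr0.
  rewrite le_eqVlt => /orP[/eqP->|wb].
    by rewrite /l /s divfK ?subr_eq0 ?gt_eqF//; lra.
  (* The mean slopes of [h] on [[a, w]] and [[w, b]] are [v c1 < v c2], which is convexity at
     [w]. *)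
  have [w1 w1E|c1 /andP[ac1 c1w] E1] := @mvt_lt _ h v a w aw.
    by apply: dh; lra.
  have [w1 w1E|c2 /andP[wc2 c2b] E2] := @mvt_lt _ h v w b wb.
    by apply: dh; lra.
  have v12 : v c1 < v c2 by apply: vi; lra.
  rewrite /l /s mulrAC -lerBlDl ler_pdivlMr ?subr_gt0//.
  have -> : h b - h a = (h b - h w) + (h w - h a) by lra.
  rewrite E1 E2.
  have : 0 <= (w - a) * (b - w) * (v c2 - v c1).
    by rewrite !mulr_ge0 ?subr_ge0 ?ltW.
  by nra.
have la : l a = h a by rewrite /l subrr mulr0 addr0.
have lb : l b = h b by rewrite /l /s divfK ?subr_eq0 ?gt_eqF//; lra.
pose E w := (h a)^-1 * ((w - a) / l w) + f w.
have dE w : a <= w <= b -> is_derive w 1 E ((l w)^-2 - (h w)^-2).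
  move=> awb; have w0 : 0 < w by lra.
  have hw := h0 _ w0; have hwl := hl _ awb.
  apply: is_derive_mobius_add; rewrite ?lt0r_neq0 ?h0//; last exact: df.
  exact: lt_le_trans hwl.
have [c cab Ec] := mvt_lt ab dE.
have cab' : a <= c <= b by lra.
have hc : 0 < h c by apply: h0; lra.
have : E b - E a <= 0.
  rewrite Ec mulr_le0_ge0 ?(subr_ge0 a) ?(ltW ab)// subr_le0.
  have lc := hl _ cab'.
  rewrite lef_pV2 ?posrE ?exprn_gt0// ?(lt_le_trans hc)//.
  by rewrite ler_pXn2r ?nnegrE// ltW// (lt_le_trans hc).
have ha := h0 _ a0; have hb : 0 < h b by apply: h0; lra.
rewrite /E la lb subrr mul0r mulr0 add0r => EE.
have : (h a)^-1 * ((b - a) / h b) <= f a - f b by lra.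
by rewrite ler_pdivrMl// ler_pdivrMr// mulrAC.
Qed.

(** Two lines of common slope, through the points of the graph of [h] over [a'] and [b'], lie below
    [h] on the outer sides. Since [f] exchanges the gaps [a' - a] and [b - b'], the two resulting
    estimates can be added. The case [a' = b'] is that of a fixed point. *)
Lemma no_nested_cycles (R : realType) (f h v : R -> R) (a a' b b' : R) :
  0 < a -> a < a' -> a' <= b' -> b' < b ->
  f a = b -> f b = a -> f a' = b' -> f b' = a' ->
  (forall w : R, 0 < w -> 0 < h w) ->
  (forall w : R, 0 < w -> is_derive w 1 f (- (h w) ^- 2)) ->
  (forall w : R, 0 < w -> is_derive w 1 h (v w)) ->
  (forall w u : R, 0 < w -> w < u -> v w < v u) ->
  1 <= h a' * h b' -> False.
Proof.
move=> a0 aa' a'b' b'b fa fb fa' fb' h0 df dh vi hh.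
have [s [l1 l2]] : exists s,
    (forall w, a <= w < a' -> h a' + s * (w - a') < h w) /\
    (forall w, b' < w <= b -> h b' + s * (w - b') < h w).
  (* The slope is that of the chord of [h], or of its tangent if [a' = b']; in both cases it is
     [v xi] with [xi] in [[a', b']], so monotonicity of [v] compares it with the slopes outside. *)
  have [xi xi1 xi2] : exists2 xi, a' <= xi <= b' &
      h b' - h a' = v xi * (b' - a').
    move: a'b'; rewrite le_eqVlt => /orP[/eqP<-|a'b'].
      by exists a'; rewrite ?lexx// !subrr mulr0.
    have [w wE|xi xiE E] := @mvt_lt _ h v _ _ a'b'; first by apply: dh; lra.
    by exists xi => //; lra.
  exists (v xi); split => w wE.
    have wa : w < a' by lra.
    have [u uE|c cE E] := @mvt_lt _ h v _ _ wa; first by apply: dh; lra.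
    have : v c < v xi by apply: vi; lra.
    by nra.
  have bw : b' < w by lra.
  have [u uE|c cE E] := @mvt_lt _ h v _ _ bw; first by apply: dh; lra.
  have : v xi < v c by apply: vi; lra.
  by nra.
(* The two estimates below add up to
   [(a' - a) * (h b' - (h a')^-1) + (b - b') * (h a' - (h b')^-1) < 0]. *)
have o1 : (h a' + s * (a - a')) * `|f a - f a'| < `|a - a'| / h a'.
  apply: line_below_diff_lt => //; [lra| by rewrite gt_eqF|].
  by move=> w /orP[] ?; [lra|apply: l1].
have o2 : (h b' + s * (b - b')) * `|f b - f b'| < `|b - b'| / h b'.
  apply: line_below_diff_lt => //; [lra|lra|by rewrite lt_eqF|].
  by move=> w /orP[] ?; [apply: l2|lra].
move: o1 o2; rewrite fa fa' fb fb' [`|a - _|]distrC.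
rewrite (gtr0_norm (_ : 0 < b - b')) ?subr_gt0//.
rewrite (gtr0_norm (_ : 0 < a' - a)) ?subr_gt0//.
have h1 : 0 < h a' by apply: h0; lra.
have h2 : 0 < h b' by apply: h0; lra.
(* The terms in [s] cancel in the sum, and [1 <= h a' * h b'] makes both brackets nonnegative. *)
have i1 : (h a')^-1 <= h b' by rewrite -div1r ler_pdivrMr// mulrC.
have i2 : (h b')^-1 <= h a' by rewrite -div1r ler_pdivrMr.
move=> o1 o2.
have : (a' - a) / h a' <= (a' - a) * h b' by rewrite ler_pM2l ?subr_gt0.
have : (b - b') / h b' <= (b - b') * h a' by rewrite ler_pM2l ?subr_gt0.
by move: o1 o2; nra.
Qed.

(** * Negative Schwarzian derivative and convexity *)

(** The function [h] is [(- f1)] to the power [-1/2], written with [expR] and [ln]; [v] is its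
    derivative and [dv], minus half of [h] times the Schwarzian, its second derivative. Strict
    convexity is recorded as strict growth of [v]. *)
Lemma schwarzian_convex (R : realType) (f1 f2 f3 : R -> R) :
  (forall w : R, 0 < w -> f1 w < 0) ->
  (forall w : R, 0 < w -> is_derive w 1 f1 (f2 w)) ->
  (forall w : R, 0 < w -> is_derive w 1 f2 (f3 w)) ->
  (forall w : R, 0 < w ->
    f3 w / f1 w - 3 / 2 * (f2 w / f1 w) ^+ 2 < 0) ->
  exists h v : R -> R, [/\ (forall w : R, 0 < w -> 0 < h w),
    (forall w : R, 0 < w -> f1 w = - (h w) ^- 2),
    (forall w : R, 0 < w -> is_derive w 1 h (v w)) &
    (forall w u : R, 0 < w -> w < u -> v w < v u)].
Proof.
move=> n1 d1 d2 Sf.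
pose h w := expR (- 2^-1 * ln (- f1 w)).
pose v w := h w * (- 2^-1 * (f2 w / f1 w)).
pose dv w := - 2^-1 * h w * (f3 w / f1 w - 3 / 2 * (f2 w / f1 w) ^+ 2).
have dh (w : R) : 0 < w -> is_derive w 1 h (v w).
  move=> w0; have p1 : 0 < - f1 w by rewrite oppr_gt0 n1.
  have dl := @is_derive1_comp R (@ln R) (- f1) w _ _
    (is_derive1_ln p1) (is_deriveN (d1 _ w0)).
  have de := @is_derive1_comp R (@expR R) _ w _ _
    (is_derive_expR _) (is_deriveZ (- 2^-1) dl).
  apply: is_derive_eq de _.
  rewrite /v /h /GRing.scale/=; congr (_ * (_ * _)).
  by rewrite invrN mulrNN mulrC.
have vE (w : R) : 0 < w -> is_derive w 1 v (dv w).
  move=> w0; have p1 := n1 _ w0; have p1' := ltr0_neq0 p1.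
  have di := is_deriveV (f := f1) p1' (d1 _ w0).
  have dq := is_deriveZ (- 2^-1) (is_deriveM (d2 _ w0) di).
  apply: is_derive_eq (is_deriveM (dh _ w0) dq) _.
  rewrite /v /dv /GRing.scale/= [X in _ + X * _](_ : _ =
    - 2^-1 * (f2 w / f1 w))//.
  by field.
exists h, v; split => //.
- by move=> w _; exact: expR_gt0.
- move=> w w0; have p1 : 0 < - f1 w by rewrite oppr_gt0 n1.
  rewrite -[LHS]opprK; congr (- _).
  rewrite /h -expRM_natl -expRN -[LHS](lnK p1); congr expR; lra.
- move=> w u w0 wu.
  have [t tE|c cE E] := @mvt_lt _ v dv _ _ wu; first by apply: vE; lra.
  rewrite -subr_gt0 E mulr_gt0 ?subr_gt0//.
  have c0 : 0 < c by lra.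
  have hc : 0 < h c by exact: expR_gt0.
  by rewrite /dv; have := Sf _ c0; nra.
Qed.

(** * Derivatives relative to the half-line *)

(** Near an interior point the constraint [0 <= z] holds automatically, so a translation identifies
    the relative difference quotient with the two-sided one. *)
Lemma diff_quot_in_halfline (R : realType) (f : R -> R) (y : R) : 0 < y ->
  diff_quot_in (halfline R) f y =
  ((fun h => h^-1 *: ((f \o shift y) (h *: 1) - f y)) @ 0^').
Proof.
move=> y0; apply/funext => P; apply/propext.
have -> : diff_quot_in (halfline R) f y P =
   \forall z \near y, z != y -> 0 <= z -> P ((f z - f y) / (z - y)) by [].
have -> : ((fun h => h^-1 *: ((f \o shift y) (h *: 1) - f y)) @ 0^') P =
   \forall h \near (0 : R), h != 0 -> P (h^-1 *: (f (h *: 1 + y) - f y)) by [].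
rewrite (near_shift 0 y) subr0.
have hy : \forall h \near (0 : R), 0 <= h + y.
  have := @near_shift R R 0 y (fun z => 0 <= z); rewrite subr0 => <-.
  by near=> z; rewrite ltW//; near: z; exact: (cvgr_gt _ cvg_id).
have E h : (f (h + y) - f y) / (h + y - y) = h^-1 *: (f (h *: 1 + y) - f y).
  by rewrite addrK mulrC /GRing.scale/= mulr1.
split => H; near=> h => /=.
- move=> h0; rewrite -E; apply: (near H h) => //=; last exact: (near hy h).
  by rewrite -subr_eq0 addrK.
- by move=> h0 _; rewrite E; apply: (near H h) => //; rewrite -subr_eq0 addrK in h0.
Unshelve. all: by end_near. Qed.

Lemma derivable_in_halfline (R : realType) (f : R -> R) (y : R) : 0 < y ->
  derivable_in (halfline R) f y ->
  is_derive y 1 f (derive_in (halfline R) f y).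
Proof.
move=> y0; rewrite /derivable_in /derive_in (diff_quot_in_halfline f y0) => df.
exact: (@DeriveDef _ _ _ _ _ _ _ df (erefl _)).
Qed.

(** The one-sided derivative controls [f] only next to the end point; this is enough to extend
    strict decrease from positive arguments to 0. *)
Lemma derive_in0_lt0 (R : realType) (f : R -> R) :
  derivable_in (halfline R) f 0 -> derive_in (halfline R) f 0 < 0 ->
  exists2 e, 0 < e & forall z, 0 < z < e -> f z < f 0.
Proof.
move=> cf f0; have H : \forall z \near (0 : R), z != 0 -> 0 <= z ->
  (f z - f 0) / (z - 0) < 0 by exact: (cvgr_lt _ cf 0 f0).
have [e /= e0 He] := H.
exists e => // z /andP[z0 ze].
have : (f z - f 0) / (z - 0) < 0.
  apply: He => /=; rewrite ?gt_eqF ?ltW//.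
  by rewrite sub0r normrN gtr0_norm.
by rewrite subr0 pmulr_llt0 ?invr_gt0// subr_lt0.
Qed.

(** * Differential inequalities and asymptotic bounds for solutions *)

(** With the integrating factor [expR t], the function [(u t - B) * expR t] is nonincreasing, so the
    excess of [u] over [B] is at most a constant times [expR (- t)]. *)
Lemma ode_eventually_le (R : realType) (u : R -> R) (T B c : R) : B < c ->
  (forall t, T < t -> derivable u t 1 /\ derive1 u t <= B - u t) ->
  \forall t \near +oo, u t <= c.
Proof.
move=> Bc du.
pose w t := (u t - B) * expR t.
pose dw t := (u t - B) * expR t + expR t * derive1 u t.
have wE (t : R) : T < t -> is_derive t 1 w (dw t).
  move=> /du[+ _] => /derivableP ut; rewrite /dw derive1E.
  have duB : is_derive t 1 (fun t => u t - B) ('D_1 u t).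
    by apply: is_derive_eq; rewrite subr0.
  exact: is_deriveM duB (is_derive_expR t).
have wT t : T + 1 < t -> w t <= w (T + 1).
  move=> Tt; have [r rE|r rE E] := @mvt_lt _ w dw _ _ Tt; first by apply: wE; lra.
  rewrite -subr_le0 E mulr_le0_ge0 ?subr_ge0 ?(ltW Tt)// /dw.
  have Tr : T < r by lra.
  rewrite mulrC -mulrDr mulr_ge0_le0 ?expR_ge0//.
  by have [_] := du _ Tr; lra.
near=> t.
have Tt : T + 1 < t by near: t; apply: nbhs_pinfty_gt; rewrite num_real.
(* The bound [1 + t <= expR t] already makes the right side exceed any constant. *)
have wt : w (T + 1) <= (c - B) * expR t.
  rewrite -ler_pdivrMl ?subr_gt0// (le_trans _ (expR_ge1Dx t))//.
  rewrite -lerBlDl; near: t; apply: nbhs_pinfty_ge; exact: num_real.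
have := le_trans (wT _ Tt) wt.
by rewrite ler_pM2r ?expR_gt0// lerD2r.
Unshelve. all: by end_near. Qed.

Lemma ode_eventually_ge (R : realType) (u : R -> R) (T B c : R) : c < B ->
  (forall t, T < t -> derivable u t 1 /\ B - u t <= derive1 u t) ->
  \forall t \near +oo, c <= u t.
Proof.
move=> cB du.
have : \forall t \near +oo, (- u) t <= - c.
  apply: (@ode_eventually_le _ _ T (- B)); first by rewrite ltrN2.
  move=> t /du[ut utB]; split; first exact: derivableN.
  by rewrite derive1E deriveN// -derive1E -[(- u) t]/(- u t); move: utB; lra.
by apply: filterS => t; rewrite fctE lerN2.
Qed.

Lemma delay_eventually_ge (R : realType) (tau : R) (f x : R -> R) (b c : R) :
  (forall y u : R, 0 <= y -> y <= u -> f u <= f y) ->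
  nonneg_solution tau f x ->
  (\forall t \near +oo, x t <= b) -> c < f b -> \forall t \near +oo, c <= x t.
Proof.
move=> fd [_ x0 dx] [M [_ HM]] cf.
(* The equation holds for [t > 0], and the bound on the delayed value [x (t - tau)] needs
   [t - tau > M]. *)
apply: (@ode_eventually_ge _ _ (Num.max 0 (M + tau)) _ _ cf) => t.
rewrite gt_max => /andP[t0 Mt]; have [dt ->] := dx _ t0; split => //.
by rewrite addrC lerD2l fd ?x0 ?HM//; lra.
Qed.

Lemma delay_eventually_le (R : realType) (tau : R) (f x : R -> R) (a c : R) :
  0 <= a -> (forall y u : R, 0 <= y -> y <= u -> f u <= f y) ->
  nonneg_solution tau f x ->
  (\forall t \near +oo, a <= x t) -> f a < c -> \forall t \near +oo, x t <= c.
Proof.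
move=> a0 fd [_ x0 dx] [M [_ HM]] cf.
apply: (@ode_eventually_le _ _ (Num.max 0 (M + tau)) _ _ cf) => t.
rewrite gt_max => /andP[t0 Mt]; have [dt ->] := dx _ t0; split => //.
by rewrite addrC lerD2r fd ?HM//; lra.
Qed.

(** [A] is the supremum of the eventual lower bounds of [x] and [B] the infimum of its eventual
    upper bounds. Monotone [f] sends bounds of one kind to bounds of the other, up to a slack
    removed by continuity. *)
Lemma solution_bounds (R : realType) (tau : R) (f x : R -> R) :
  (forall y : R, 0 <= y -> 0 < f y) ->
  (forall y u : R, 0 <= y -> y <= u -> f u <= f y) ->
  (forall y : R, 0 < y -> {for y, continuous f}) ->
  nonneg_solution tau f x ->
  exists A B : R, [/\ 0 < A, f B <= A, A <= B /\ B <= f A,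
    (forall a, a < A -> \forall t \near +oo, a <= x t) &
    (forall b, B < b -> \forall t \near +oo, x t <= b)].
Proof.
move=> f0 fd fc xs; have [_ x0 _] := xs.
have nx0 : \forall t \near +oo, 0 <= x t.
  near=> t; apply: x0; near: t; apply: nbhs_pinfty_ge; exact: num_real.
pose L := [set a | \forall t \near +oo, a <= x t].
pose U := [set b | \forall t \near +oo, x t <= b].
have LU a b : L a -> U b -> a <= b.
  by move=> La Ub; have [t [/le_trans]] := filter_ex (filterI La Ub); apply.
have f01 : 0 <= f 0 + 1 by rewrite addr_ge0// ltW// f0.
(* The added 1 here and the division by 2 in [L1] supply the strict inequalities that the comparison
   requires; the positive bound in [L1] yields [0 < A]. *)
have U1 : U (f 0 + 1) by apply: (delay_eventually_le _ fd xs nx0); rewrite ?ltrDl.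
have p1 := f0 _ f01.
have L1 : L (f (f 0 + 1) / 2) by apply: (delay_eventually_ge fd xs U1); lra.
have supL : has_sup L.
  by split; [exists 0|exists (f 0 + 1) => a /LU; exact].
have infU : has_inf U.
  by split; [exists (f 0 + 1)|exists 0 => b; exact: LU].
have LA a : a < sup L -> L a.
  move=> /(sup_gt (ex_intro _ _ L1))[a' La' aa'].
  by apply: filterS La' => t; apply: le_trans; exact: ltW.
have UB b : inf U < b -> U b.
  move=> /(inf_lt (ex_intro _ _ U1))[b' Ub' bb'].
  by apply: filterS Ub' => t /le_trans; apply; exact: ltW.
have leA a : L a -> a <= sup L by exact: (sup_upper_bound supL).
have geB b : U b -> inf U <= b by exact: (ge_inf infU.2).
have A0 : 0 < sup L by apply: lt_le_trans (leA _ L1); lra.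
have AB : sup L <= inf U.
  apply: ge_sup => [|a La]; first by exists 0.
  by apply: lb_le_inf => [|b]; [exists (f 0 + 1)|exact: LU].
exists (sup L), (inf U); split => //.
- apply/ler_addgt0Pr => e e0; rewrite -lerBlDr.
  (* By continuity some [b] slightly above [inf U] has [f b > f (inf U) - e]; as [b] is an eventual
     upper bound, [f (inf U) - e] is an eventual lower one. *)
  have cB : f (inf U) - e < f (inf U) by rewrite gtrBl.
  have cf := cvgr_gt _ (cvg_at_right_filter (fc _ (lt_le_trans A0 AB))) _ cB.
  have [b [Bb cb]] := filter_ex (filterI (nbhs_right_gt (inf U)) (cf _)).
  exact/leA/(delay_eventually_ge fd xs (UB _ Bb)).
- split => //; apply/ler_addgt0Pr => e e0.
  (* Symmetrically from the left of [sup L], with [a] kept positive so that monotonicity of [f]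
     applies. *)
  have cA : f (sup L) < f (sup L) + e by rewrite ltrDl.
  have cf := cvgr_lt _ (cvg_at_left_filter (fc _ A0)) _ cA.
  have [a [[aA a0] ca]] := filter_ex (filterI (filterI
    (nbhs_left_lt (sup L)) (nbhs_left_gt A0)) (cf _)).
  exact/geB/(delay_eventually_le (ltW a0) fd xs (LA _ aA)).
Unshelve. all: by end_near. Qed.

(** * Fixed points of the map and of its second iterate *)

Lemma iterate2_fixed_point (R : realType) (f : R -> R) (y : R) :
  (forall y : R, 0 <= y -> 0 < f y) ->
  (forall y u : R, 0 <= y -> y <= u -> f u <= f y) ->
  (forall y : R, 0 < y -> {for y, continuous f}) ->
  0 < y -> f (f y) <= y -> exists2 z, 0 < z <= y & f (f z) = z.
Proof.
move=> f0 fd fc y0 fy.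
(* The second iterate is nondecreasing, so [e <= f (f 0) <= f (f e)]. The interval [[e, y]] avoids
   0, where continuity is not assumed. *)
pose e := Num.min y (f (f 0)).
have e0 : 0 < e by rewrite lt_min y0 f0// ltW// f0.
have ey : e <= y by rewrite ge_min lexx.
have fe : e <= f (f e).
  rewrite (@le_trans _ _ (f (f 0)))//; first by rewrite ge_min lexx orbT.
  by apply: (fd); [exact/ltW/f0/ltW|apply: (fd) => //; exact: ltW].
have cg : {within `[e, y], continuous (fun z => f (f z) - z)}.
  apply: continuous_in_subspaceT => z; rewrite inE/= in_itv/= => /andP[ez _].
  have z0 : 0 < z by exact: lt_le_trans ez.
  apply: cvgB; last exact: cvg_id.
  apply: (@continuous_comp _ _ _ f f); apply: fc => //.
  by apply/f0/ltW.
have [|z] := IVT ey cg (v := 0).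
  by rewrite le_max ge_min; apply/andP; split; apply/orP; [right|left]; lra.
rewrite in_itv/= => /andP[ez zy] E; exists z; first by rewrite zy (lt_le_trans e0).
by lra.
Qed.

Lemma decreasing_fixed_point (R : realType) (f : R -> R) :
  (forall y : R, 0 <= y -> 0 < f y) ->
  (forall y u : R, 0 <= y -> y <= u -> f u <= f y) ->
  (forall y : R, 0 < y -> {for y, continuous f}) ->
  exists2 z, 0 < z & f z = z.
Proof.
move=> f0 fd fc.
(* This choice gives [e <= f 1 <= f e], hence [f (f e) <= f e], and [f z - z] changes sign on
   [[e, f e]]. *)
pose e := Num.min 1 (f 1).
have e0 : 0 < e by rewrite lt_min ltr01 f0.
have fe : e <= f e.
  rewrite (@le_trans _ _ (f 1))//; first by rewrite ge_min lexx orbT.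
  by apply: (fd); [exact: ltW|rewrite ge_min lexx].
have cg : {within `[e, f e], continuous (fun z => f z - z)}.
  apply: continuous_in_subspaceT => z; rewrite inE/= in_itv/= => /andP[ez _].
  apply: cvgB; last exact: cvg_id.
  by apply: fc; exact: lt_le_trans ez.
have [|z] := IVT fe cg (v := 0).
  rewrite le_max ge_min; apply/andP; split; apply/orP; [right|left]; last lra.
  by rewrite subr_le0 fd// ltW.
rewrite in_itv/= => /andP[ez _] E; exists z; first exact: lt_le_trans ez.
by lra.
Qed.

(** * Lower and upper limits at infinity *)

Lemma liminf_infty_ge (R : realType) (x : R -> R) (A : R) :
  (forall a, a < A -> \forall t \near +oo, a <= x t) ->
  (A%:E <= liminf_infty x)%E.
Proof.
move=> H; rewrite /liminf_infty limf_einfE; apply/lee_subgt0Pr => e e0.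
rewrite -EFinB.
have HV : \forall t \near +oo, A - e <= x t by apply: H; rewrite gtrBl.
apply: le_trans (ereal_sup_ubound _); last first.
  by exists [set t | A - e <= x t]; [exact: HV|reflexivity].
by apply: le_ereal_inf_tmp => _ [t At <-]; rewrite lee_fin.
Qed.

Lemma limsup_infty_le (R : realType) (x : R -> R) (B : R) :
  (forall b, B < b -> \forall t \near +oo, x t <= b) ->
  (limsup_infty x <= B%:E)%E.
Proof.
move=> H; rewrite /limsup_infty limf_esupE; apply/lee_addgt0Pr => e e0.
rewrite -EFinD.
have HV : \forall t \near +oo, x t <= B + e by apply: H; rewrite ltrDl.
apply: le_trans (ereal_inf_lbound _) _.
  by exists [set t | x t <= B + e]; [exact: HV|reflexivity].
by apply: ge_ereal_sup => _ [t At <-]; rewrite lee_fin.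
Qed.

(** Any two neighbourhoods of infinity share a point, whose value lies between the infimum over one
    and the supremum over the other. *)
Lemma liminf_infty_le_limsup (R : realType) (x : R -> R) :
  (liminf_infty x <= limsup_infty x)%E.
Proof.
rewrite /liminf_infty /limsup_infty limf_einfE limf_esupE.
apply: ge_ereal_sup => _ [V FV <-]; apply: le_ereal_inf_tmp => _ [W FW <-].
have [t [Vt Wt]] := filter_ex (filterI FV FW).
apply: (@le_trans _ _ (x t)%:E).
- by apply: ereal_inf_lbound; exists t.
- by apply: ereal_sup_ubound; exists t.
Qed.

(** * S-maps and their 2-cycles *)

Lemma S_map_regular (R : realType) (f : R -> R) : S_map f ->
  [/\ (forall y : R, 0 <= y -> 0 < f y),
      (forall y u : R, 0 <= y -> y < u -> f u < f y),
      (forall y : R, 0 < y ->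
         is_derive y 1 f (derive_in (halfline R) f y)) &
      exists h v : R -> R, [/\ (forall w : R, 0 < w -> 0 < h w),
        (forall w : R, 0 < w -> derive_in (halfline R) f w = - (h w) ^- 2),
        (forall w : R, 0 < w -> is_derive w 1 h (v w)) &
        (forall w u : R, 0 < w -> w < u -> v w < v u)]].
Proof.
move=> [fI fd Sf f1].
have df n (y : R) : (n < 3)%N -> 0 < y -> is_derive y 1
    (derive_in_n (halfline R) n f) (derive_in_n (halfline R) n.+1 f y).
  by move=> n3 y0; apply/derivable_in_halfline/fd => //; exact: ltW.
have fdec0 (y u : R) : 0 < y -> y < u -> f u < f y.
  move=> y0 yu.
  have [w wE|c cE E] := @mvt_lt _ f (derive_in (halfline R) f) _ _ yu.
    by apply: (df 0%N) => //; lra.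
  rewrite -subr_lt0 E pmulr_llt0 ?subr_gt0// f1// /halfline/=; lra.
have fdec (y u : R) : 0 <= y -> y < u -> f u < f y.
  rewrite le_eqVlt => /orP[/eqP<- u0|]; last exact: fdec0.
  have [|e e0 fe] := derive_in0_lt0 (fd 0%N _ isT (lexx 0)).
    exact/f1/lexx.
  (* Beyond the range [e] of the one-sided estimate at 0, the comparison passes through [e / 2]. *)
  have [eu|ue] := leP e u; last by apply: fe; rewrite u0.
  by apply: (@lt_trans _ _ (f (e / 2))); [apply: fdec0|apply: fe]; lra.
split => //.
- move=> y y0; apply: (@le_lt_trans _ _ (f (y + 1))).
    by apply: fI; rewrite /halfline/=; lra.
  by apply: fdec => //; lra.
- by move=> y; exact: (df 0%N).
- apply: (@schwarzian_convex R _ (derive_in_n (halfline R) 2 f)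
    (derive_in_n (halfline R) 3 f)).
  + by move=> w /ltW; exact: f1.
  + by move=> w; exact: (df 1%N).
  + by move=> w; exact: (df 2%N).
  + by move=> w /ltW; exact: Sf.
Qed.

(** Since [f] decreases, distinct 2-cycles are nested; the chord estimate for the inner one then
    contradicts [no_nested_cycles]. *)
Lemma two_cycle_unique (R : realType) (f : R -> R) (a b a' b' : R) :
  S_map f -> 0 < a -> a < b -> f a = b -> f b = a ->
  0 < a' -> a' < b' -> f a' = b' -> f b' = a' -> a = a'.
Proof.
move=> /S_map_regular[_ fd df [h [v [h0 fh dh vi]]]].
have df' (y : R) : 0 < y -> is_derive y 1 f (- h y ^- 2).
  by move=> y0; rewrite -fh//; exact: df.
wlog aa' : a b a' b' / a < a'.
  move=> H a0 ab fa fb a'0 ab' fa' fb'.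
  have [aa'|aa'|//] := ltgtP a a'; first by apply: (H a b a' b').
  by apply/esym; apply: (H a' b' a b).
move=> a0 ab fa fb a'0 ab' fa' fb'; exfalso.
have bb' : b' < b by rewrite -fa -fa' fd// ltW.
apply: (no_nested_cycles a0 aa' (ltW ab') bb' fa fb fa' fb' h0 df' dh vi).
have := diff_le_chord a'0 ab' h0 df' dh vi.
by rewrite fa' fb' -{1}[b' - a']mul1r ler_pM2r// subr_gt0.
Qed.

(** The fixed point serves as a degenerate inner cycle [a' = b' = K], for which [1 <= h K * h K] is
    the assumption on the derivative. *)
Lemma no_two_cycle (R : realType) (f : R -> R) (K a b : R) :
  S_map f -> f K = K -> `|derive_in (halfline R) f K| <= 1 ->
  0 < a -> a < K -> f a = b -> f b = a -> False.
Proof.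
move=> /S_map_regular[_ fd df [h [v [h0 fh dh vi]]]] fK.
have df' (y : R) : 0 < y -> is_derive y 1 f (- h y ^- 2).
  by move=> y0; rewrite -fh//; exact: df.
move=> f1 a0 aK fa fb.
have K0 : 0 < K by exact: lt_trans aK.
have Kb : K < b by rewrite -fa -{1}fK fd// ltW.
apply: (no_nested_cycles a0 aK (lexx K) Kb fa fb fK fK h0 df' dh vi).
move: f1; rewrite fh// normrN ger0_norm ?invr_ge0 ?sqr_ge0//.
by rewrite invf_le1 ?exprn_gt0 ?h0.
Qed.

(** The second iterate has derivative [d * d > 1] at [K], so just to the left of [K] its graph is
    below the diagonal. *)
Lemma iterate2_below (R : realType) (f : R -> R) (K d : R) :
  0 < K -> f K = K -> is_derive K 1 f d -> 1 < `|d| ->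
  exists2 y, 0 < y < K & f (f y) < y.
Proof.
move=> K0 fK df d1.
have dg : is_derive K 1 (f \o f) (d * d).
  by apply: is_derive1_comp; rewrite ?fK.
have [cg gE] := dg.
have cq : (fun h => h^-1 *: ((f \o f \o shift K) (h *: 1) - (f \o f) K)) @ 0^' -->
   d * d by rewrite -gE; exact: cg.
have dd : 1 < d * d by rewrite -[d * d]real_normK ?num_real// exprn_egt1.
have H : \forall h \near (0 : R), h != 0 ->
  1 < h^-1 * (f (f (h * 1 + K)) - f (f K)) by exact: (cvgr_gt _ cq 1 dd).
have [e /= e0 He] := H.
(* Less than [e] for the difference quotient estimate, and less than [K] so that [K - h] is
   positive. *)
pose h := Num.min e K / 2.
have m0 : 0 < Num.min e K by rewrite lt_min e0.
have h0 : 0 < h by rewrite divr_gt0.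
have me : Num.min e K <= e by rewrite ge_min lexx.
have mK : Num.min e K <= K by rewrite ge_min lexx orbT.
have he : h < e by rewrite /h; lra.
have hK : h < K by rewrite /h; lra.
exists (K - h); first lra.
have : 1 < (- h)^-1 * (f (f (- h * 1 + K)) - f (f K)).
  by apply: He; rewrite ?oppr_eq0 ?gt_eqF//= sub0r opprK gtr0_norm.
rewrite mulr1 !fK [- h + K]addrC invrN mulNr -mulrN ltr_pdivlMl// mulr1; lra.
Qed.

(** * Asymptotic behaviour of the solutions *)

Theorem proposition5 :
  forall (R : realType) (tau : R) (f : R -> R),
  0 < tau -> S_map f ->
  exists K : R,
    [/\ fixed_point f K,
        forall y : R, fixed_point f y -> y = K,
        `|derive_in (halfline R) f K| <= 1 ->
          forall x : R -> R, nonneg_solution tau f x ->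
            x t @[t --> +oo] --> K
      & 1 < `|derive_in (halfline R) f K| ->
          exists alpha beta : R,
            [/\ alpha < beta,
                two_cycle f [set alpha; beta],
                forall C : set R, two_cycle f C -> C = [set alpha; beta]
              & forall x : R -> R, nonneg_solution tau f x ->
                  [/\ (alpha%:E <= liminf_infty x)%E,
                      (liminf_infty x <= limsup_infty x)%E
                    & (limsup_infty x <= beta%:E)%E]]].
Proof.
move=> R tau f _ Sf; have [f0 fd df _] := S_map_regular Sf.
have fle (y u : R) : 0 <= y -> y <= u -> f u <= f y.
  by move=> y0; rewrite le_eqVlt => /orP[/eqP->//|/(fd _ _ y0)/ltW].
have fc (y : R) : 0 < y -> {for y, continuous f}.
  move=> /df dy; apply/differentiable_continuous/derivable1_diffP.
  exact: ex_derive.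
have [K K0 fK] := decreasing_fixed_point f0 fle fc.
have above (y : R) : 0 <= y -> y < K -> K < f y.
  by move=> y0 /(fd _ _ y0); rewrite fK.
exists K; split.
- by split=> //; exact: ltW.
- move=> y [y0 fy]; have [yK|yK|//] := ltgtP y K.
    by have := above _ y0 yK; rewrite fy ltNge (ltW yK).
  by have := fd _ _ (ltW K0) yK; rewrite fK fy ltNge (ltW yK).
- move=> f1 x xs.
  have [A [B [A0 BA [AB BfA] lA uB]]] := solution_bounds f0 fle fc xs.
  (* From [B <= f A] follows [f (f A) <= f B <= A]. *)
  have ffA : f (f A) <= A.
    by apply: le_trans BA; rewrite fle// (le_trans (ltW A0)).
  have [z /andP[z0 zA] ffz] := iterate2_fixed_point f0 fle fc A0 ffA.
  (* Otherwise [z] and [f z] would form a 2-cycle around [K]. Hence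
     [K <= A <= B <= f A <= f K = K]. *)
  have Kz : K <= z.
    rewrite leNgt; apply/negP => zK.
    exact: (no_two_cycle Sf fK f1 z0 zK erefl ffz).
  have KA : K <= A by exact: le_trans zA.
  have BK : B <= K by rewrite -fK (le_trans BfA)// fle// ltW.
  apply/cvgrPdist_le => e e0; near=> t; rewrite ler_distlC; apply/andP; split.
    by near: t; apply: lA; lra.
  by near: t; apply: uB; lra.
- move=> f1; have [y /andP[y0 yK] ffy] := iterate2_below K0 fK (df _ K0) f1.
  (* The fixed point [al] of the second iterate lies below [K] and [f al] above it, so they form the
     2-cycle. *)
  have [al /andP[a0 ay] ffa] := iterate2_fixed_point f0 fle fc y0 (ltW ffy).
  have aK : al < K by exact: le_lt_trans yK.
  have Kb := above _ (ltW a0) aK; have ab := lt_trans aK Kb.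
  have uniq a b : 0 < a -> a < b -> f a = b -> f b = a -> a = al.
    by move=> *; apply: (@two_cycle_unique _ f a b al (f al)).
  exists al, (f al); split => //.
  + exists al, (f al); split => //; last by move=> E; rewrite -E ltxx in ab.
    by split; apply/ltW => //; exact: lt_trans ab.
  + move=> C [a [b [-> [/f0 fa0 /f0 fb0] /eqP + fab fba]]].
    (* Each element of a cycle is a value of [f], hence positive; the smaller of the two must be
       [al]. *)
    rewrite fab fba in fa0 fb0.
    rewrite neq_lt => /orP[ltab|ltba].
      by rewrite -fab (uniq a b).
    by rewrite setUC -fba (uniq b a).
  + move=> x xs.
    have [A [B [A0 BA [AB BfA] lA uB]]] := solution_bounds f0 fle fc xs.
    have ffA : f (f A) <= A.
      by apply: le_trans BA; rewrite fle// (le_trans (ltW A0)).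
    have [z /andP[z0 zA] ffz] := iterate2_fixed_point f0 fle fc A0 ffA.
    (* If [z < K] then [z] is the smaller element of a 2-cycle, so it equals [al]; otherwise
       [al < K <= z]. *)
    have alA : al <= A.
      apply: le_trans zA; have [zK|Kz] := ltP z K; last first.
        by rewrite ltW// (lt_le_trans aK).
      by rewrite -(uniq z (f z))// (lt_trans zK)// above// ltW.
    split; [|exact: liminf_infty_le_limsup|].
      by apply: liminf_infty_ge => a aal; apply: lA; exact: lt_le_trans alA.
    apply: limsup_infty_le => b fb; apply: uB; apply: le_lt_trans fb.
    by apply: (le_trans BfA); rewrite fle// ltW.
Unshelve. all: by end_near. Qed.
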